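(* Let $S\neq\mathbb{N}$ be a numerical semigroup with $e(S)\ge t(S)+1$. Then the following are equivalent: (i) $W(S)=0$; (ii) $e(S)=t(S)+1$ and $c(S)=(t(S)+1)\,n(S)$; (iii) $e(S)=2$, or $S=T_{m,k}$ for some integers $m\ge3$, $k\ge1$.
   Context: $\mathbb{N}=\{0,1,2,\dots\}$. A numerical semigroup is a submonoid $S\subseteq\mathbb{N}$ (under addition) with finite complement. Let $S\ne\mathbb{N}$. $F$ is the largest element of $\mathbb{N}\setminus S$, $c(S)=F+1$ is the conductor, and $n(S)=|S\cap[0,c(S))|$. The embedding dimension $e(S)$ is the cardinality of the unique minimal system of generators of $S$. An integer $f$ is a pseudo-Frobenius number if $f\notin S$ and $f+s\in S$ for all $s\in S\setminus\{0\}$; the type $t(S)$ is the number of these. The Wilf number is $W(S)=e(S)n(S)-c(S)$. For $m\ge2$ and $k\ge1$, $T_{m,k}=\{0,m,2m,\dots,(k-1)m\}\cup\{x\in\mathbb{N}: x\ge km\}$. *)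

(* Defs.v *)
From mathcomp Require Import all_boot all_order all_algebra finmap.
From mathcomp Require Import boolp classical_sets functions cardinality.

Set Implicit Arguments.
Unset Strict Implicit.
Unset Printing Implicit Defensive.

Local Open Scope classical_set_scope.

Definition submonoid (S : set nat) : Prop :=
  S 0 /\ forall x y, S x -> S y -> S (x + y).

Definition numerical_semigroup (S : set nat) : Prop :=
  submonoid S /\ finite_set (~` S).

(* The maximum of an empty set is 0, so this is the Frobenius number only for
   S <> setT. *)
Definition frobenius (S : set nat) : nat := \max_(x <- fset_set (~` S)) x.

Lemma frobenius_max (S : set nat) :
  numerical_semigroup S -> S <> setT ->
  ~ S (frobenius S) /\ forall x, ~ S x -> x <= frobenius S.
Proof.
move=> [_ Sfin] ST; have ub x : ~ S x -> x <= frobenius S.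
  move=> nSx; apply: (@leq_bigmax_seq _ _ xpredT (fun x => x) x) => //.
  by rewrite in_fset_set// inE.
split=> // SF; apply: ST; apply/seteqP; split=> // x _; apply: contrapT => nSx.
suff : ~ S (frobenius S) by [].
have xin : x \in fset_set (~` S) by rewrite in_fset_set// inE.
rewrite /frobenius; have : (fset_set (~` S) : seq nat) != [::].
  by apply/eqP => e; have : x \in (fset_set (~` S) : seq nat) := xin; rewrite e.
have : forall y, y \in (fset_set (~` S) : seq nat) -> ~ S y.
  move=> y yin; have : y \in fset_set (~` S) := yin.
  by rewrite in_fset_set// inE.
elim: (fset_set (~` S) : seq nat) => // a [|b s] IH h _.
  by rewrite big_seq1; apply: h; rewrite inE.
rewrite big_cons /maxn; case: ifP => _; last by apply: h; rewrite inE eqxx.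
by apply: IH => // y ys; apply: h; rewrite inE ys orbT.
Qed.

Definition conductor (S : set nat) : nat := (frobenius S).+1.

Lemma conductor_le (S : set nat) (x : nat) :
  numerical_semigroup S -> conductor S <= x -> S x.
Proof.
move=> hS cx; have [->//|ST] := pselect (S = setT).
have [_ ub] := frobenius_max hS ST.
by apply: contrapT => /ub; rewrite leqNgt cx.
Qed.

Definition nsmall (S : set nat) : nat :=
  #|` fset_set (S `&` [set x | x < conductor S]) |%fset.

Definition generated (A : set nat) : set nat := smallest submonoid A.

Definition minimal_generators (S A : set nat) : Prop :=
  generated A = S /\
  forall B : set nat, B `<=` A -> generated B = S -> B = A.

Lemma minimal_generators_unique (S : set nat) :
  numerical_semigroup S ->
  exists2 A, finite_set A & forall B, minimal_generators S B <-> B = A.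
Proof.
move=> hS; have [[S0 SD] _] := hS.
pose A := [set x | [/\ S x, x <> 0 &
  forall y z, S y -> S z -> y <> 0 -> z <> 0 -> x <> y + z]].
have Sgen B : B `<=` S -> generated B `<=` S.
  by move=> BS x; apply; split.
have subgen B : B `<=` generated B by move=> x Bx M [_]; apply.
have genS B : generated B = S -> B `<=` S by move=> <-; exact: subgen.
have genmono B C : B `<=` C -> generated B `<=` generated C.
  by move=> BC x Bx M [M1 M2]; apply: Bx; split=> // y /BC/M2.
have AS : A `<=` S by move=> x [].
have genA : generated A = S.
  apply/seteqP; split; first exact: Sgen.
  move=> x; have [n] := ubnP x; elim: n x => // n IH x xn Sx.
  have [Ax|nAx] := pselect (A x); first exact: subgen.
  have [->|x0] := eqVneq x 0; first by move=> M [[]].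
  have [y [z [Sy Sz y0 z0 xyz]]] : exists y z,
      [/\ S y, S z, y <> 0, z <> 0 & x = y + z].
    apply: contrapT => h; apply: nAx; split => //; first exact/eqP.
    by move=> y z Sy Sz y0 z0 e; apply: h; exists y, z.
  have gy : generated A y.
    apply: IH => //; move/eqP: z0; rewrite -lt0n => z0.
    by rewrite (leq_trans _ (xn : x <= n))// xyz -addn1 leq_add2l.
  have gz : generated A z.
    apply: IH => //; move/eqP: y0; rewrite -lt0n => y0.
    by rewrite (leq_trans _ (xn : x <= n))// xyz -add1n leq_add2r.
  by rewrite xyz => M hM; have [[_ MD] _] := hM; apply: MD; [exact: gy|exact: gz].
have Amin B : generated B = S -> A `<=` B.
  move=> gB x [Sx x0 xirr]; apply: contrapT => nBx.
  have : generated B x by rewrite gB.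
  move=> /(_ [set y | S y /\ y <> x]) [] //; split; last first.
    by move=> y By; split; [exact: genS By|move=> yx; apply: nBx; rewrite -yx].
  split; first by split=> // /esym.
  move=> y z [Sy yx] [Sz zx]; split; first exact: SD.
  have [->|/eqP y0] := eqVneq y 0; first by rewrite add0n.
  have [->|/eqP z0] := eqVneq z 0; first by rewrite addn0.
  by move/esym; exact: xirr.
exists A; last first.
  move=> B; split=> [[gB Bmin]|->]; first by apply/esym/Bmin => //; exact: Amin.
  by split=> // C CA gC; apply/seteqP; split=> //; exact: Amin.
have SN x : conductor S <= x -> S x by exact: conductor_le.
set N := conductor S in SN.
apply: (@sub_finite_set _ _ `I_(N + N)); last exact: finite_II.
move=> x [Sx _ xirr] /=; rewrite ltnNge; apply/negP => NNx.
have Nx : N <= x by rewrite (leq_trans _ NNx) ?leq_addr.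
have NxN : N <= x - N by rewrite leq_subRL.
apply: (xirr N (x - N)); [exact: SN|exact: SN|by []| |by rewrite subnKC].
by move=> e; move: NxN; rewrite e.
Qed.

(* By minimal_generators_unique, for a numerical semigroup the set picked here
   is its one and only minimal system of generators, and it is finite. *)
Definition embedding_dimension (S : set nat) : nat :=
  #|` fset_set (xget set0 (minimal_generators S)) |%fset.

(* f ranges over all integers; no negative one qualifies when S <> setT, as the
   proof of pseudo_frobenius_finite shows. *)
Definition pseudo_frobenius (S : set nat) : set int :=
  [set f : int | ~ (Posz @` S) f /\
    forall s : nat, S s -> s <> 0 -> (Posz @` S) (f + s%:Z)%R].

Lemma pseudo_frobenius_finite (S : set nat) :
  numerical_semigroup S -> S <> setT -> finite_set (pseudo_frobenius S).
Proof.
move=> hS ST; apply: (@sub_finite_set _ _ (Posz @` (~` S))); last first.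
  by apply: finite_image; case: hS.
move=> [n|n] [nS h]; first by exists n => // Sn; apply: nS; exists n.
have [nF _] := frobenius_max hS ST.
have Ss : S (frobenius S + n.+1) by apply: conductor_le => //; rewrite addnS ltnS leq_addr.
have s0 : frobenius S + n.+1 <> 0 by rewrite addnS.
have [y Sy] := h _ Ss s0.
rewrite NegzE PoszD GRing.addrC GRing.addrK => -[yF].
by case: nF; rewrite -yF.
Qed.

Definition sg_type (S : set nat) : nat :=
  #|` fset_set (pseudo_frobenius S) |%fset.

(* Integer-valued, since subtraction on nat is truncated. *)
Definition wilf (S : set nat) : int :=
  ((embedding_dimension S * nsmall S)%N%:Z - (conductor S)%:Z)%R.

Definition Tmk (m k : nat) : set nat :=
  [set x | exists2 j, j < k & x = j * m] `|` [set x | k * m <= x].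

(* Main.v *)
(* Every gap x of S can be written x = f - s with f pseudo-Frobenius and s in S,
   so (f, s) |-> f - s covers the c - n gaps by t n pairs and c <= (t + 1) n;
   this gives the equivalence of (i) and (ii).  When c = (t + 1) n the covering
   is a bijection.  Let m be the multiplicity and g a minimal generator with
   m < g < c.  For each pseudo-Frobenius f, the gap f - g has a unique
   representation, which forces f - g + m to lie in S; then g - m lies below
   every f, so by uniqueness t = 1.  Hence if t >= 2 the elements of S below c
   are the multiples of m, and S = T_{m,k}. *)
Require Import Defs.
From mathcomp Require Import all_boot all_order all_algebra finmap.
From mathcomp Require Import boolp classical_sets functions cardinality.
From mathcomp Require Import zify.

Local Open Scope classical_set_scope.

(** * Cardinalities of injective images of finite types *)

Lemma card_fset_set_image (I : finType) (T : choiceType) (g : I -> T)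
    (P : set I) : injective g ->
  #|` fset_set (g @` P)|%fset = #|[set i : I | `[< P i >]]%SET|.
Proof.
move=> ginj.
have -> : fset_set (g @` P) = [fset g i | i in [set i : I | `[< P i >]]%SET]%fset.
  apply/fsetP => x; rewrite in_fset_set; last exact/finite_image/finite_finset.
  apply/idP/idP.
    rewrite inE => -[i Pi <-]; apply/imfsetP; exists i => //=.
    by rewrite inE; apply/asboolP.
  move=> /imfsetP[i /=]; rewrite inE => /asboolP Pi ->.
  by rewrite inE; exists i.
by rewrite card_imfset //= cardE.
Qed.

Lemma card_fset_set_range (n : nat) (T : choiceType) (g : 'I_n -> T) :
  injective g -> #|` fset_set (range g)|%fset = n.
Proof.
move=> ginj; rewrite card_fset_set_image // -[RHS]card_ord -cardsT.
by apply: eq_card => i; rewrite !inE; apply/asboolP.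
Qed.

(** * Pseudo-Frobenius numbers, small elements and gaps below the conductor *)

Definition pseudo_frobenius_nat (S : set nat) : set nat :=
  [set f | ~ S f /\ forall s, S s -> s <> 0 -> S (f + s)].

Lemma pseudo_frobeniusE (S : set nat) :
  numerical_semigroup S -> S <> setT ->
  pseudo_frobenius S = Posz @` pseudo_frobenius_nat S.
Proof.
move=> hS hSN; apply/seteqP; split => [[n|n] [nS h]|_ [f [nSf h] <-]].
- exists n => //; split=> [Sn|s Ss s0]; first by apply: nS; exists n.
  by have [y Sy] := h _ Ss s0; rewrite -PoszD => -[<-].
- have [nF _] := frobenius_max hS hSN.
  (* A negative integer [-(n + 1)] cannot qualify: adding [frobenius S + n.+1], which is in [S],
     lands on the Frobenius number, a gap. *)
  have Ss : S (frobenius S + n.+1).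
    by apply: conductor_le => //; rewrite /conductor; lia.
  have [y Sy yE] := h _ Ss ltac:(lia).
  by case: nF; have <- : y = frobenius S by lia.
- split=> [[y Sy [yf]]|s Ss s0]; first by apply: nSf; rewrite -yf.
  by exists (f + s) => //; exact: h.
Qed.

Lemma gap_lt_conductor (S : set nat) (x : nat) :
  numerical_semigroup S -> ~ S x -> x < conductor S.
Proof. by move=> hS nSx; rewrite ltnNge; apply/negP => /(conductor_le hS). Qed.

Lemma frobenius_pseudo_frobenius (S : set nat) :
  numerical_semigroup S -> S <> setT -> pseudo_frobenius_nat S (frobenius S).
Proof.
move=> hS hSN; have [nF _] := frobenius_max hS hSN; split=> // s _ s0.
by apply: conductor_le => //; rewrite /conductor; lia.
Qed.

Lemma conductorP (S : set nat) (c : nat) :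
  numerical_semigroup S -> ~ S c -> (forall x, c < x -> S x) ->
  conductor S = c.+1.
Proof.
move=> hS nSc cS; congr _.+1.
have [nF ub] := frobenius_max hS (fun e => nSc ltac:(by rewrite e)).
by apply/eqP; rewrite eqn_leq ub // andbT leqNgt; apply/negP => /cS.
Qed.

(** Taken inside the ordinals below the conductor, which contain every gap, so that the complement
    of [small_elements S] is exactly the set of gaps. *)
Definition small_elements (S : set nat) : {set 'I_(conductor S)} :=
  [set i : 'I_(conductor S) | `[< S i >]]%SET.

Definition pf_elements (S : set nat) : {set 'I_(conductor S)} :=
  [set i : 'I_(conductor S) | `[< pseudo_frobenius_nat S i >]]%SET.

Lemma nsmallE (S : set nat) : nsmall S = #|small_elements S|.
Proof.
rewrite -(@card_fset_set_image _ _ val _ val_inj); congr (#|` fset_set _ |)%fset.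
apply/seteqP; split=> [x [Sx xc]|_ [i Si <-]]; first by exists (Ordinal xc).
by split=> //=; exact: ltn_ord.
Qed.

Lemma sg_typeE (S : set nat) :
  numerical_semigroup S -> S <> setT -> sg_type S = #|pf_elements S|.
Proof.
move=> hS hSN; rewrite /sg_type pseudo_frobeniusE //.
have inj : injective (fun i : 'I_(conductor S) => Posz i).
  by move=> i j [] /val_inj.
rewrite -(card_fset_set_image _ _ _ _ inj); congr (#|` fset_set _ |)%fset.
apply/seteqP; split=> [_ [f fP <-]|_ [i iP <-]]; last by exists i.
by exists (Ordinal (gap_lt_conductor _ _ hS fP.1)).
Qed.

Lemma conductor_card (S : set nat) :
  conductor S = nsmall S + #|~: small_elements S|.
Proof. by rewrite nsmallE cardsC card_ord. Qed.

(** * Covering the gaps by differences f - s, and the bound c <= (t + 1) n *)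

Lemma gap_below_pseudo_frobenius (S : set nat) (x : nat) :
  numerical_semigroup S -> ~ S x ->
  exists f s, [/\ pseudo_frobenius_nat S f, S s & x + s = f].
Proof.
move=> hS; have [[S0 SD] _] := hS.
(* Ascend through the gaps: a gap that is not pseudo-Frobenius has a larger gap [x + s] with [s] in
   [S], and all gaps lie below the conductor. *)
have [n] := ubnP (conductor S - x); elim: n x => // n IH x xn nSx.
have xc := gap_lt_conductor _ _ hS nSx.
have [xP|xP] := pselect (pseudo_frobenius_nat S x).
  by exists x, 0; split=> //; rewrite addn0.
have [s [Ss s0 nSxs]] : exists s, [/\ S s, s <> 0 & ~ S (x + s)].
  apply: contrapT => h; apply: xP; split=> // s Ss s0.
  by apply: contrapT => nSxs; apply: h; exists s.
have [||f [s' [fP Ss' e]]] := IH (x + s); [lia|by []|].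
by exists f, (s + s'); split=> //; [exact: SD|rewrite addnA].
Qed.

(* Truncated: s > f gives 0, which lies in S and so is never a gap. *)
Definition ord_diff (c : nat) (p : 'I_c * 'I_c) : 'I_c :=
  Ordinal (leq_ltn_trans (leq_subr p.2 p.1) (ltn_ord p.1)).

Lemma gaps_sub_diff (S : set nat) : numerical_semigroup S ->
  ~: small_elements S \subset
    (@ord_diff _ @: finset.setX (pf_elements S) (small_elements S))%SET.
Proof.
move=> hS; apply/fintype.subsetP => i; rewrite !inE => /asboolP nSi.
have [f [s [fP Ss e]]] := gap_below_pseudo_frobenius _ _ hS nSi.
have fc := gap_lt_conductor _ _ hS fP.1.
have sc : s < conductor S by lia.
apply/imsetP; exists (Ordinal fc, Ordinal sc).
  by rewrite !inE /=; apply/andP; split; apply/asboolP.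
by apply: val_inj => /=; lia.
Qed.

Lemma card_gaps_le (S : set nat) :
  numerical_semigroup S -> S <> setT ->
  #|~: small_elements S| <= sg_type S * nsmall S.
Proof.
move=> hS hSN; rewrite sg_typeE // nsmallE -cardsX.
exact: leq_trans (subset_leq_card (gaps_sub_diff _ hS)) (leq_imset_card _ _).
Qed.

Lemma conductor_le_type_nsmall (S : set nat) :
  numerical_semigroup S -> S <> setT ->
  conductor S <= (sg_type S + 1) * nsmall S.
Proof.
by move=> hS hSN; have := card_gaps_le _ hS hSN; have := conductor_card S; lia.
Qed.

(** * The equality case c = (t + 1) n *)

Lemma diff_bij_of_conductor_eq (S : set nat) :
  numerical_semigroup S -> S <> setT ->
  conductor S = (sg_type S + 1) * nsmall S ->
  ((@ord_diff _ @: finset.setX (pf_elements S) (small_elements S))%SET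
     = ~: small_elements S) /\
  {in finset.setX (pf_elements S) (small_elements S) &, injective (@ord_diff _)}.
Proof.
move=> hS hSN ceq; have sub := gaps_sub_diff _ hS.
(* There are now as many gaps as pairs, so the image of the pairs, which contains the gaps, has no
   room for anything else or for a collision. *)
have gE : #|~: small_elements S| = #|finset.setX (pf_elements S) (small_elements S)|.
  by rewrite cardsX -sg_typeE // -nsmallE; have := conductor_card S; lia.
have le := leq_imset_card (@ord_diff _) (finset.setX (pf_elements S) (small_elements S)).
split.
  by apply/esym/eqP; rewrite eqEcard sub gE.
apply/imset_injP; rewrite eqn_leq le -gE.
exact: subset_leq_card.
Qed.

Lemma small_lt_pseudo_frobenius (S : set nat) (f s : nat) :
  numerical_semigroup S -> S <> setT ->
  conductor S = (sg_type S + 1) * nsmall S ->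
  pseudo_frobenius_nat S f -> S s -> s < conductor S -> s < f.
Proof.
move=> hS hSN ceq fP Ss sc; have [im _] := diff_bij_of_conductor_eq _ hS hSN ceq.
have fc := gap_lt_conductor _ _ hS fP.1.
have : ord_diff _ (Ordinal fc, Ordinal sc) \in ~: small_elements S.
  rewrite -im; apply: imset_f; rewrite !inE /=.
  by apply/andP; split; apply/asboolP.
(* If [f <= s], the truncated difference would be 0, which is not a gap. *)
rewrite !inE /= => /asboolP nS; rewrite ltnNge -subn_eq0; apply/negP => /eqP e.
by apply: nS; rewrite e; case: hS => -[].
Qed.

(** Injectivity of the difference map in additive form: the pairs [(x + s, s)] and [(x + s', s')]
    have the same difference [x]. *)
Lemma pseudo_frobenius_above_unique (S : set nat) (x s s' : nat) :
  numerical_semigroup S -> S <> setT ->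
  conductor S = (sg_type S + 1) * nsmall S ->
  pseudo_frobenius_nat S (x + s) -> pseudo_frobenius_nat S (x + s') ->
  S s -> S s' -> s = s'.
Proof.
move=> hS hSN ceq fP fP' Ss Ss'; have [_ inj] := diff_bij_of_conductor_eq _ hS hSN ceq.
have fc := gap_lt_conductor _ _ hS fP.1; have fc' := gap_lt_conductor _ _ hS fP'.1.
have sc : s < conductor S by lia.
have sc' : s' < conductor S by lia.
have /(_ _ _ _)/(congr1 (fun p => val p.2)) := inj (Ordinal fc, Ordinal sc) (Ordinal fc', Ordinal sc').
apply; rewrite ?inE /=; try by apply/andP; split; apply/asboolP.
by apply: val_inj => /=; lia.
Qed.

Lemma multiplicity_exists (S : set nat) : numerical_semigroup S ->
  exists m, [/\ S m, 0 < m & forall s, S s -> 0 < s -> m <= s].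
Proof.
move=> hS.
have ex : exists m, `[< S m >] && (0 < m).
  exists (conductor S); rewrite andbC /=; apply/asboolP.
  exact: conductor_le.
have [m /andP[/asboolP Sm m0] mmin] := ex_minnP ex.
exists m; split=> // s Ss s0; apply: mmin.
by apply/andP; split=> //; apply/asboolP.
Qed.

Lemma submonoid_muln (S : set nat) (m j : nat) :
  submonoid S -> S m -> S (j * m).
Proof.
by move=> [S0 SD] Sm; elim: j => // j IH; rewrite mulSn; exact: SD.
Qed.

Lemma last_gap_in_progression (S : set nat) (m x : nat) :
  numerical_semigroup S -> 0 < m -> ~ S x ->
  exists l, ~ S (x + l * m) /\ S (x + l.+1 * m).
Proof.
move=> hS m0 nSx.
have ex : exists j, `[< S (x + j * m) >].
  (* Since [0 < m], that many steps of size [m] reach the conductor. *)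
  by exists (conductor S); apply/asboolP; apply: conductor_le => //; nia.
have [[|l] /asboolP Sl lmin] := ex_minnP ex; first by rewrite addn0 in Sl.
by exists l; split=> // Sxl; have := lmin l ltac:(exact/asboolP); rewrite ltnn.
Qed.

Lemma small_dvd_multiplicity (S : set nat) (m f f' s : nat) :
  numerical_semigroup S -> S <> setT ->
  conductor S = (sg_type S + 1) * nsmall S ->
  S m -> 0 < m -> (forall s, S s -> 0 < s -> m <= s) ->
  pseudo_frobenius_nat S f -> pseudo_frobenius_nat S f' -> f <> f' ->
  S s -> s < conductor S -> m %| s.
Proof.
move=> hS hSN ceq Sm m0 mmin fP fP' ff'; have [Smon _] := hS.
have [n] := ubnP s; elim: n s => // g IH s sg Ss sc.
apply: contrapT => /negP nms.
have s0 : 0 < s by rewrite lt0n; apply: contra nms => /eqP ->; exact: dvdn0.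
(* Positive summands would be smaller than [s], hence multiples of [m] by induction; so [s] is a
   minimal generator. *)
have irr a b : S a -> S b -> 0 < a -> 0 < b -> s <> a + b.
  move=> Sa Sb a0 b0 sab; move/negP: nms; apply.
  by rewrite sab dvdn_add //; apply: IH => //; lia.
have ms := mmin _ Ss s0.
have sm : s <> m by move=> e; rewrite e dvdnn in nms.
(* The witness is [w = h - s + m]. To see that it lies in [S], climb from the gap [h - s] in steps
   of [m] to the last gap, and write that gap as [h' - u]. *)
have above h : pseudo_frobenius_nat S h -> exists2 w, S w & s - m + w = h.
  move=> hP.
  have sh := small_lt_pseudo_frobenius _ _ _ hS hSN ceq hP Ss sc.
  have nSx : ~ S (h - s).
    by move=> Sx; apply: hP.1; rewrite -(subnK (ltnW sh)); apply: Smon.2.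
  have [l [nSl Sl]] := last_gap_in_progression _ _ _ hS m0 nSx.
  have [h' [u [h'P Su e]]] := gap_below_pseudo_frobenius _ _ hS nSl.
  have Slm : S (l * m) by exact: submonoid_muln.
  (* Both [s] and [l * m + u] lead from [h - s] to a pseudo-Frobenius number. As [s] is irreducible
     and not a multiple of [m], this forces [l = 0]. *)
  have su : s = l * m + u.
    apply: (pseudo_frobenius_above_unique _ (h - s) _ _ hS hSN ceq) => //.
    - by rewrite subnK // ltnW.
    - by rewrite addnA e.
    - exact: Smon.2.
  have l0 : l = 0.
    apply/eqP; rewrite -leqn0 leqNgt; apply/negP => l0.
    have [u0|u0] := posnP u; last by apply: (irr (l * m) u) => //; nia.
    by move/negP: nms; apply; rewrite su u0 addn0 dvdn_mull.
  by exists (h - s + m); [rewrite l0 mul1n in Sl|lia].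
have [w Sw wE] := above _ fP; have [w' Sw' wE'] := above _ fP'.
(* Now [s - m] lies below both [f] and [f'] by elements of [S], which uniqueness forbids for
   distinct [f] and [f']. *)
apply: ff'; rewrite -wE -wE'; congr (_ + _).
by apply: (pseudo_frobenius_above_unique _ (s - m) _ _ hS hSN ceq);
  rewrite ?wE ?wE'.
Qed.

Lemma Tmk_of_conductor_eq (S : set nat) :
  numerical_semigroup S -> S <> setT ->
  conductor S = (sg_type S + 1) * nsmall S -> 1 < sg_type S ->
  exists m k : nat, [/\ 3 <= m, 1 <= k & S = Tmk m k].
Proof.
move=> hS hSN ceq; rewrite sg_typeE // => /card_gt1P[i [j []]].
rewrite !inE => fP fP' /eqP ij.
have {ij} ff' : nat_of_ord i <> j by move=> /val_inj.
move: (nat_of_ord i) (nat_of_ord j) fP fP' ff' => f f' fP fP' ff' {i j}.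
have [Smon _] := hS; have [S0 SD] := Smon.
have [m [Sm m0 mmin]] := multiplicity_exists _ hS.
have dvd s : S s -> s < conductor S -> m %| s.
  exact: (small_dvd_multiplicity _ _ _ _ _ hS hSN ceq Sm m0 mmin fP fP' ff').
have dvdS s : m %| s -> S s by move=> /dvdnP[q ->]; exact: submonoid_muln.
have m1 : m <> 1 by move=> m1; apply: fP.1; apply: dvdS; rewrite m1 dvd1n.
(* If [m = 2], all pseudo-Frobenius numbers are odd, so two distinct ones differ by a nonzero even
   element of [S], which puts the larger one in [S]. *)
have m2 : m <> 2.
  move=> m2.
  have odd_gap x : pseudo_frobenius_nat S x -> odd x.
    move=> [nSx _]; apply: contrapT => /negP ox.
    by apply: nSx; apply: dvdS; rewrite m2 dvdn2.
  have noadd x y : pseudo_frobenius_nat S x -> pseudo_frobenius_nat S y -> ~ x < y.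
    move=> xP yP xy; apply: yP.1; rewrite -(subnKC (ltnW xy)).
    apply: xP.2; last lia.
    by apply: dvdS; rewrite m2 dvdn2 oddB ?(odd_gap x) ?(odd_gap y) // ltnW.
  by case: (ltngtP f f') => // /noadd; apply.
have mc : m %| conductor S.
  have c0 : m <= conductor S by apply: mmin => //; exact: conductor_le.
  apply: contrapT => /negP nmc.
  set c := conductor S in dvd c0 nmc *; set q := c %/ m.
  have cE : c = q * m + c %% m := divn_eq c m.
  have r0 : 0 < c %% m by rewrite lt0n.
  have rm : c %% m < m by rewrite ltn_mod.
  have q0 : 0 < q by rewrite divn_gt0.
  have qm : m <= q * m by rewrite leq_pmull.
  (* If [m] did not divide [c], then [q * m - 1] would be pseudo-Frobenius, because adding at least
     [m] to it reaches [c]. But the small element [q * m] exceeds it, against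
     [small_lt_pseudo_frobenius]. *)
  have gP : pseudo_frobenius_nat S (q * m - 1).
    split=> [Sg|s Ss s0].
      have := dvd _ Sg ltac:(lia).
      rewrite dvdn_subr ?dvdn_mull //; last lia.
      by rewrite dvdn1 => /eqP.
    have := mmin _ Ss; rewrite lt0n => /(_ ltac:(exact/eqP)) sm.
    by apply: conductor_le => //; rewrite -/c; lia.
  have := small_lt_pseudo_frobenius _ _ (q * m) hS hSN ceq gP.
  by move=> /(_ (submonoid_muln _ _ _ Smon Sm)); rewrite -/c => /(_ ltac:(lia)); lia.
exists m, (conductor S %/ m); split; [lia| |].
  by rewrite divn_gt0 // dvdn_leq.
apply/seteqP; split=> x; rewrite /Tmk /= divnK //.
  move=> Sx; have [cx|xc] := leqP (conductor S) x; [by right|left].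
  have /dvdnP[j xE] := dvd _ Sx xc; exists j => //.
  by rewrite -(ltn_pmul2r m0) divnK // -xE.
by move=> [[j _ ->]|]; [exact: submonoid_muln|exact: conductor_le].
Qed.

(** * Elementary bounds on c, t and n *)

Lemma nsmall_double_le (S : set nat) :
  numerical_semigroup S -> S <> setT -> 2 * nsmall S <= conductor S.
Proof.
move=> hS hSN; have [[S0 SD] _] := hS; have [nF _] := frobenius_max hS hSN.
suff : nsmall S <= #|~: small_elements S| by have := conductor_card S; lia.
(* On ordinals below c = F + 1, [rev_ord] is the reflection s -> F - s, which sends small elements
   to gaps. *)
rewrite nsmallE -(card_imset _ (@rev_ord_inj (conductor S))).
apply/subset_leq_card/fintype.subsetP => _ /imsetP[i iS ->].
rewrite !inE in iS *; apply/asboolP => /= Sr.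
apply: nF; have -> : frobenius S = i + (conductor S - i.+1).
  by have := ltn_ord i; rewrite /conductor; lia.
exact: SD.
Qed.

Lemma sg_type_gt0 (S : set nat) :
  numerical_semigroup S -> S <> setT -> 0 < sg_type S.
Proof.
move=> hS hSN; rewrite sg_typeE //; apply/card_gt0P.
exists (Ordinal (ltnSn (frobenius S))); rewrite inE; apply/asboolP.
exact: frobenius_pseudo_frobenius.
Qed.

Lemma nsmall_gt0 (S : set nat) : numerical_semigroup S -> 0 < nsmall S.
Proof.
move=> [[S0 _] _]; rewrite nsmallE; apply/card_gt0P.
by exists ord0; rewrite inE; apply/asboolP.
Qed.

(** * Minimal generators and the invariants of T_{m,k} *)

Lemma minimal_generators_irreducible (S A : set nat) :
  submonoid S -> generated A = S ->
  (forall x, A x -> x <> 0 /\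
    forall y z, S y -> S z -> y <> 0 -> z <> 0 -> x <> y + z) ->
  minimal_generators S A.
Proof.
move=> [S0 SD] gA irr; split=> // B BA gB; apply/seteqP; split=> // x Ax.
have [x0 xirr] := irr _ Ax.
have subgen C : C `<=` generated C by move=> y Cy M [_]; apply.
apply: contrapT => nBx.
have : generated B x by rewrite gB -gA; exact: subgen.
(* Since [x] is irreducible, [S] without [x] is still a submonoid; it contains [B], so [B] cannot
   generate [x]. *)
move=> /(_ [set y | S y /\ y <> x]) [] //; split; last first.
  move=> y By; split; first by rewrite -gB; exact: subgen.
  by move=> yx; apply: nBx; rewrite -yx.
split; first by split=> // /esym.
move=> y z [Sy yx] [Sz zx]; split; first exact: SD.
have [->|/eqP y0] := eqVneq y 0; first by rewrite add0n.
have [->|/eqP z0] := eqVneq z 0; first by rewrite addn0.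
by move/esym; exact: xirr.
Qed.

Lemma embedding_dimensionP (S A : set nat) :
  numerical_semigroup S -> minimal_generators S A ->
  embedding_dimension S = #|` fset_set A|%fset.
Proof.
move=> hS mA; have [A' _ uniq] := minimal_generators_unique hS.
rewrite /embedding_dimension; congr (#|` fset_set _ |)%fset.
case: xgetP => [B _ /uniq ->|/(_ A)] //; by apply/esym/uniq.
Qed.

Lemma Tmk_multiplicity_le (m k x : nat) : 0 < k -> Tmk m k x -> x <> 0 -> m <= x.
Proof.
move=> k0 [[[|j] _ ->]|/= kx] x0 //; first by rewrite mulSn leq_addr.
by apply: leq_trans kx; rewrite leq_pmull.
Qed.

(** These gaps fill the last block before [k * m]. They turn out to be all the pseudo-Frobenius
    numbers, and [i = m - 1] gives the Frobenius number. *)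
Lemma Tmk_gap (m k i : nat) : 0 < k -> 0 < i -> i < m ->
  ~ Tmk m k (k.-1 * m + i).
Proof.
move=> k0 i0 im [[j jk e]|/=]; last by rewrite -{1}(prednK k0) mulSn; lia.
have : m %| k.-1 * m + i by rewrite e dvdn_mull.
by rewrite dvdn_addr ?dvdn_mull // => /dvdn_leq; lia.
Qed.

(* Ordinal 0 encodes the generator m. *)
Definition Tmk_generator (m k : nat) (i : 'I_m) : nat :=
  if i == 0 :> nat then m else k * m + i.

Lemma Tmk_embedding_dimension (m k : nat) :
  1 < m -> 0 < k -> numerical_semigroup (Tmk m k) ->
  embedding_dimension (Tmk m k) = m.
Proof.
move=> m1 k0 hT; have [Tmon _] := hT.
have ginj : injective (Tmk_generator m k).
  move=> i j; have := ltn_ord i; have := ltn_ord j.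
  rewrite /Tmk_generator; do 2 case: eqP => ? //; move=> jm im e;
    apply: val_inj => /=; nia.
rewrite (embedding_dimensionP _ (range (Tmk_generator m k)) hT) ?card_fset_set_range //.
apply: minimal_generators_irreducible => //.
  apply/seteqP; split=> [x|x].
    apply; split=> // _ [i _ <-]; rewrite /Tmk_generator; case: eqP => _.
      have [->|k1] := eqVneq k 1; first by right; rewrite /= mul1n.
      by left; exists 1; [lia|rewrite mul1n].
    by right; rewrite /= leq_addr.
  move=> Tx M [Mmon gM].
  have Mm : M m.
    have m0 : 0 < m by lia.
    by apply: gM; exists (Ordinal m0) => //.
  have [r0|r0] := posnP (x %% m).
    by rewrite (divn_eq x m) r0 addn0; exact: submonoid_muln.
  have rm : x %% m < m by rewrite ltn_mod; lia.
  case: Tx => [[j _ xE]|/= kx]; first by rewrite xE; exact: submonoid_muln.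
  have kd : k <= x %/ m by rewrite leq_divRL //; lia.
  (* The generator with the residue of [x] modulo [m], plus a multiple of [m]. *)
  have -> : x = (x %/ m - k) * m + (k * m + x %% m).
    by rewrite addnA -mulnDl subnK // -divn_eq.
  apply: Mmon.2; first exact: submonoid_muln.
  apply: gM; exists (Ordinal rm) => //.
  by rewrite /Tmk_generator /= ifF //; lia.
move=> _ [i _ <-]; rewrite /Tmk_generator; have im := ltn_ord i.
case: eqP => i0.
  split; first lia.
  move=> y z Ty Tz y0 z0 e.
  by have := Tmk_multiplicity_le _ _ _ k0 Ty y0; have := Tmk_multiplicity_le _ _ _ k0 Tz z0; lia.
split; first lia.
move=> y z Ty Tz y0 z0 e.
have ym := Tmk_multiplicity_le _ _ _ k0 Ty y0; have zm := Tmk_multiplicity_le _ _ _ k0 Tz z0.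
(* Neither summand reaches k m, so both are multiples of m. *)
have lt a b : m <= b -> k * m + i = a + b -> Tmk m k a -> m %| a.
  move=> mb e' [[j _ ->]|/= ka]; [exact: dvdn_mull|lia].
have : m %| k * m + i.
  by rewrite e dvdn_add //; [apply: (lt y z)|apply: (lt z y)] => //; lia.
by rewrite dvdn_addr ?dvdn_mull // => /dvdn_leq; lia.
Qed.

Lemma Tmk_conductor (m k : nat) :
  1 < m -> 0 < k -> numerical_semigroup (Tmk m k) -> conductor (Tmk m k) = k * m.
Proof.
move=> m1 k0 hT; have km : 0 < k * m by nia.
rewrite (@conductorP _ (k * m).-1) ?prednK //; last by right => /=; lia.
have -> : (k * m).-1 = k.-1 * m + m.-1 by case: k k0 {hT km} => //= k _; lia.
by apply: Tmk_gap; lia.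
Qed.

Lemma Tmk_nsmall (m k : nat) :
  1 < m -> 0 < k -> numerical_semigroup (Tmk m k) -> nsmall (Tmk m k) = k.
Proof.
move=> m1 k0 hT; rewrite /nsmall Tmk_conductor //.
have ginj : injective (fun i : 'I_k => i * m).
  by move=> i j e; apply: val_inj => /=; nia.
rewrite -[RHS](card_fset_set_range _ _ _ ginj); congr (#|` fset_set _ |)%fset.
apply/seteqP; split=> [x [[[j jk ->]|/= kx] /= xk]|_ [i _ <-]].
- by exists (Ordinal jk).
- by lia.
- by have := ltn_ord i; split; [left; exists i|rewrite /= ltn_pmul2r; lia].
Qed.

Lemma Tmk_type (m k : nat) :
  1 < m -> 0 < k -> numerical_semigroup (Tmk m k) -> Tmk m k <> setT ->
  sg_type (Tmk m k) = m.-1.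
Proof.
move=> m1 k0 hT hTN.
have ginj : injective (fun i : 'I_m.-1 => Posz (k.-1 * m + i.+1)).
  by move=> i j [e]; apply: val_inj => /=; lia.
rewrite -[RHS](card_fset_set_range _ _ _ ginj); congr (#|` fset_set _ |)%fset.
have kE : k * m = k.-1 * m + m by case: k k0 {hT hTN ginj} => //= k _; lia.
rewrite pseudo_frobeniusE //; apply/seteqP; split=> [_ [f [nTf fP] <-]|_ [i _ <-]].
  have Tm : Tmk m k m.
    have [->|k1] := eqVneq k 1; first by right; rewrite /= mul1n.
    by left; exists 1; [lia|rewrite mul1n].
  have fk : f < k * m by rewrite ltnNge; apply/negP => ?; apply: nTf; right.
  (* A gap below the last block stays a gap after adding [m], so it is not pseudo-Frobenius. *)
  have fm : k.-1 * m < f.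
    rewrite ltnNge; apply/negP => fle; case: (fP m Tm ltac:(lia)).
      move=> [j jk e]; apply: nTf; left; exists j.-1; first lia.
      by case: j jk e => [|j] _ /= e; nia.
    move=> /= kf; apply: nTf; left; exists k.-1; [lia|lia].
  have fi : f - (k.-1 * m).+1 < m.-1 by lia.
  by exists (Ordinal fi) => //=; congr Posz; lia.
have im := ltn_ord i; exists (k.-1 * m + i.+1) => //; split.
  by apply: Tmk_gap => //; lia.
by move=> s Ts s0; right; have := Tmk_multiplicity_le _ _ _ k0 Ts s0 => /=; lia.
Qed.

Theorem theorem6p4 (S : set nat) (hS : numerical_semigroup S)
    (hSN : S <> setT) (het : sg_type S + 1 <= embedding_dimension S) :
  (wilf S = 0%R <->
    (embedding_dimension S = sg_type S + 1 /\
     conductor S = (sg_type S + 1) * nsmall S)) /\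
  ((embedding_dimension S = sg_type S + 1 /\
    conductor S = (sg_type S + 1) * nsmall S) <->
    (embedding_dimension S = 2 \/
     exists m k : nat, [/\ 3 <= m, 1 <= k & S = Tmk m k])).
Proof.
have cle := conductor_le_type_nsmall _ hS hSN.
have n0 := nsmall_gt0 _ hS.
have t0 := sg_type_gt0 _ hS hSN.
split; split.
- rewrite /wilf => W0.
  have eq : embedding_dimension S * nsmall S = conductor S by lia.
  (* Cancel [0 < nsmall S] in e n = c <= (t + 1) n. *)
  have ele : embedding_dimension S = sg_type S + 1.
    by apply/eqP; rewrite eqn_leq het andbT -(leq_pmul2r n0) eq.
  by split=> //; rewrite -eq ele.
- by move=> [eE cE]; rewrite /wilf eE cE; lia.
- move=> [eE cE]; have [t1|t1] := leqP (sg_type S) 1; first by left; lia.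
  by right; exact: Tmk_of_conductor_eq.
- move=> [e2|[m [k [m3 k1 SE]]]].
    (* The hypothesis [het] and positivity of the type give t = 1; then 2 n <= c <= 2 n. *)
    have t1 : sg_type S = 1 by lia.
    have := nsmall_double_le _ hS hSN; rewrite t1 in cle *; lia.
  (* Here e = m, c = k m, n = k and t = m - 1. *)
  subst S; rewrite Tmk_embedding_dimension ?Tmk_conductor ?Tmk_nsmall ?Tmk_type //; lia.
Qed.
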